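(* Let $k\geq d\geq 2$ be integers and $f\in\mathcal{C}_d$. Algorithm OCS with function $f$ achieves a competitive ratio of at least $1-1/f(k)$ for the vertex-weighted online bipartite matching problem on $(k,d)$-bounded graphs.
   Context: Vertex-weighted online bipartite matching: bipartite graph $G=(S\cup R,E)$ with offline servers $S$ carrying non-negative weights and online requests $R$ arriving one at a time in adversarial order; on arrival of $r$ its neighbors are revealed and the algorithm irrevocably matches $r$ to an unmatched neighbor or leaves it unmatched. $\mathsf{ALG}$ is the total weight of matched servers, $\mathsf{OPT}$ the maximum weight of a matching; competitive ratio is the infimum over instances of $\mathbb{E}[\mathsf{ALG}]/\mathsf{OPT}$. $(k,d)$-bounded: every server has degree at least $k$, every request has degree at most $d$. $\mathcal{C}_d$: non-decreasing $f:\{0,1,2,\ldots\}\to\mathbb{R}$ with $f(0)=1$ such that for all integers $0\leq m\leq d-1$ and $0\leq l_1\leq\cdots\leq l_m$: $1+\frac{\sum_{i=1}^m f(l_i)}{d-m}\geq\prod_{i=1}^m\frac{f(l_i+1)}{f(l_i)}$. Algorithm OCS (with $f$): when request $r$ arrives, for each server $s$ let $l_s$ be the number of neighbors of $s$ that arrived before $r$; let $A$ be the set of unmatched neighbors of $r$; if $A\neq\emptyset$, match $r$ to $s\in A$ with probability $f(l_s)/\sum_{s'\in A}f(l_{s'})$. *)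

(* Defs.v *)
From HB Require Import structures.
From mathcomp Require Import all_boot all_order all_algebra.
From mathcomp Require Import reals constructive_ereal ereal.

Set Implicit Arguments.
Unset Strict Implicit.
Unset Printing Implicit Defensive.

Import Order.TTheory GRing.Theory Num.Theory.
Local Open Scope ring_scope.

Record instance (R : realType) := Instance {
  server : finType;
  request : finType;
  adj : server -> request -> bool;
  weight : server -> R;
  weight_ge0 : forall s, 0 <= weight s;
  arrival : seq request;
  arrival_perm : perm_eq arrival (enum request)
}.

Section Instances.
Variables (R : realType) (I : instance R).
Implicit Types (s : server I) (r : request I).

Definition edge_set := {set server I * request I}.
Implicit Types M : edge_set.

Definition kd_bounded (k d : nat) : Prop :=
  (forall s, k <= #|[set r | adj s r]|)%N /\
  (forall r, #|[set s | adj s r]| <= d)%N.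

Definition is_matching M : bool :=
  [forall e in M, adj e.1 e.2] &&
  [forall e in M, forall e' in M,
    ((e.1 == e'.1) || (e.2 == e'.2)) ==> (e == e')].

Definition matched M s : bool := [exists r, (s, r) \in M].

Definition matched_weight M : R := \sum_(s | matched M s) weight s.

(* The empty matching has weight 0, so 0 is a legitimate default. *)
Definition OPT : R := \big[Num.max/0]_(M | is_matching M) matched_weight M.

Definition arrives_before r' r : bool :=
  (index r' (arrival I) < index r (arrival I))%N.

Definition dirac M : edge_set -> R := fun M' => (M' == M)%:R.

Definition bind (p : edge_set -> R) (kern : edge_set -> edge_set -> R) :
    edge_set -> R :=
  fun M' => \sum_M p M * kern M M'.

Definition expectation (p : edge_set -> R) (X : edge_set -> R) : R :=
  \sum_M p M * X M.

Section OCS.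
Variable f : nat -> R.

(* The l_s of the algorithm, at the arrival of r. *)
Definition load r s : nat := #|[set r' | adj s r' & arrives_before r' r]|.

Definition available M r : {set server I} :=
  [set s | adj s r & ~~ matched M s].

Definition ocs_prob M r s : R :=
  f (load r s) / \sum_(s' in available M r) f (load r s').

(* ocs_step r M is the law of the edge set after the arrival of r, when M is *)
(* the set of edges selected before.                                         *)
Definition ocs_step r M : edge_set -> R :=
  if available M r == set0 then dirac M
  else fun M' =>
    \sum_(s in available M r) ocs_prob M r s * dirac ((s, r) |: M)%SET M'.

Definition ocs_law : edge_set -> R :=
  foldl (fun p r => bind p (ocs_step r)) (dirac set0) (arrival I).

End OCS.
End Instances.

(* An algorithm is given by the law, on each instance, of the set of edges it *)
(* selects. The instances with OPT = 0, for which the ratio is meaningless,   *)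
(* are left out.                                                              *)
Definition competitive_ratio (R : realType)
    (alg : forall I : instance R, edge_set I -> R)
    (P : instance R -> Prop) : \bar R :=
  ereal_inf (fun x : \bar R => exists I : instance R,
    [/\ P I, 0 < OPT I &
        x = (expectation (alg I) (@matched_weight R I) / OPT I)%:E]).

Definition C_class (R : realType) (d : nat) (f : nat -> R) : Prop :=
  [/\ {homo f : m n / (m <= n)%N >-> m <= n},
      f 0%N = 1 &
      forall (m : nat) (l : 'I_m -> nat), (m < d)%N ->
        {homo l : i j / (i <= j)%N} ->
        \prod_(i < m) (f (l i).+1 / f (l i))
          <= 1 + (\sum_(i < m) f (l i)) / (d - m)%:R].

(* Main.v *)
(** At every time, a set S of servers is entirely unmatched with probability at
    most the product over s in S of 1 / f(l_s), where l_s is the number of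
    neighbors of s arrived so far; taking S = {s} at the end gives each server
    a probability of at least 1 - 1/f(k) of being matched. When a request r
    arrives, let T be its set of neighbors in S, m = #|T| and F the sum of
    f(l_s) over T. If S is unmatched, it stays so with probability x / (x + F),
    where x is the sum of f(l_s) over the unmatched neighbors of r outside S.
    This is concave in x, and the induction hypothesis applied to s |: S bounds
    the mean of x on the event "S unmatched" by d - m times the bound for S.
    The bound for S is thus multiplied by at most (d - m) / (d - m + F), and
    the inequality defining C_d compares this factor with the product over T
    of f(l_s) / f(l_s + 1). *)

Require Import Defs.
From mathcomp Require Import all_boot all_order all_algebra.
From mathcomp Require Import reals constructive_ereal ereal.
From mathcomp Require Import ring.

Set Implicit Arguments.
Unset Strict Implicit.
Unset Printing Implicit Defensive.

Import Order.TTheory GRing.Theory Num.Theory.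
Local Open Scope ring_scope.

(** * Expectations under finite laws and under one step of OCS *)

Lemma expectation_bind (R : realType) (I : instance R)
    (p : edge_set I -> R) (K : edge_set I -> edge_set I -> R) X :
  expectation (bind p K) X = expectation p (fun M => expectation (K M) X).
Proof.
rewrite /expectation /bind.
under eq_bigr do rewrite mulr_suml.
rewrite exchange_big; apply: eq_bigr => M _.
by rewrite mulr_sumr; apply: eq_bigr => M' _; rewrite mulrA.
Qed.

Lemma expectation_dirac (R : realType) (I : instance R) (M : edge_set I) X :
  expectation (dirac M) X = X M.
Proof.
rewrite /expectation /dirac (bigD1 M) //= eqxx mul1r big1 ?addr0 //.
by move=> M' /negPf ->; rewrite mul0r.
Qed.

Lemma expectation_le (R : realType) (I : instance R) (p X Y : edge_set I -> R) :
  (forall M, 0 <= p M) -> (forall M, X M <= Y M) ->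
  expectation p X <= expectation p Y.
Proof. by move=> p0 XY; apply: ler_sum => M _; apply: ler_wpM2l. Qed.

Lemma expectationD (R : realType) (I : instance R) (p X Y : edge_set I -> R) :
  expectation p (fun M => X M + Y M) = expectation p X + expectation p Y.
Proof. by rewrite -big_split; apply: eq_bigr => M _; rewrite mulrDr. Qed.

Lemma expectationZ (R : realType) (I : instance R) (p X : edge_set I -> R) a :
  expectation p (fun M => a * X M) = a * expectation p X.
Proof. by rewrite mulr_sumr; apply: eq_bigr => M _; rewrite mulrCA. Qed.

Lemma expectation_sum (R : realType) (I : instance R) (J : finType)
    (P : pred J) (p : edge_set I -> R) (X : J -> edge_set I -> R) :
  expectation p (fun M => \sum_(j | P j) X j M) =
  \sum_(j | P j) expectation p (X j).
Proof.
by rewrite exchange_big; apply: eq_bigr => M _; rewrite mulr_sumr.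
Qed.

Lemma expectation_step (R : realType) (I : instance R) (f : nat -> R)
    (r : request I) (M : edge_set I) X :
  expectation (ocs_step f r M) X =
  if available M r == set0 then X M
  else \sum_(s in available M r) ocs_prob f M r s * X ((s, r) |: M)%SET.
Proof.
rewrite /ocs_step; case: ifP => _; first exact: expectation_dirac.
rewrite /expectation; under eq_bigr do rewrite mulr_suml.
rewrite exchange_big; apply: eq_bigr => s _.
rewrite -[X in _ = _ * X](expectation_dirac ((s, r) |: M)%SET X) mulr_sumr.
by apply: eq_bigr => M' _; rewrite mulrA.
Qed.

(** * Unmatched sets and the law after a prefix of the arrivals *)

Definition unmatched (R : realType) (I : instance R) (S : {set server I})
    (M : edge_set I) : bool :=
  [forall s in S, ~~ matched M s].

(** Allows induction on the last arrival; [ocs_law] is the case [p = arrival I], by conversion. *)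
Definition ocs_prefix (R : realType) (I : instance R) (f : nat -> R)
    (p : seq (request I)) : edge_set I -> R :=
  foldl (fun q r => bind q (ocs_step f r)) (dirac set0) p.

Lemma matched0 (R : realType) (I : instance R) (s : server I) :
  matched (set0 : edge_set I) s = false.
Proof. by apply/existsP => -[r]; rewrite inE. Qed.

Lemma matchedU1 (R : realType) (I : instance R) (s s' : server I) r
    (M : edge_set I) :
  matched ((s, r) |: M)%SET s' = (s' == s) || matched M s'.
Proof.
apply/existsP/orP => [[r'] | [/eqP -> | /existsP[r' Mr']]].
- rewrite in_setU1 xpair_eqE => /orP[/andP[-> _] | Mr']; first by left.
  by right; apply/existsP; exists r'.
- by exists r; rewrite setU11.
- by exists r'; rewrite in_setU1 Mr' orbT.
Qed.

Lemma unmatched_step (R : realType) (I : instance R) (S : {set server I})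
    (M : edge_set I) s r :
  unmatched S ((s, r) |: M)%SET = (s \notin S) && unmatched S M.
Proof.
apply/forall_inP/andP => [h | [sS /forall_inP h] s' s'S].
  split; first by apply/negP => /h; rewrite matchedU1 eqxx.
  by apply/forall_inP => s' /h; rewrite matchedU1 negb_or => /andP[].
rewrite matchedU1 negb_or h // andbT.
by apply: contraNneq sS => <-.
Qed.

Lemma unmatchedU1 (R : realType) (I : instance R) (S : {set server I})
    (M : edge_set I) s :
  unmatched (s |: S)%SET M = ~~ matched M s && unmatched S M.
Proof.
apply/forall_inP/andP => [h | [sM /forall_inP h] s'].
  split; first by rewrite h ?setU11.
  by apply/forall_inP => s' s'S; rewrite h // in_setU1 s'S orbT.
by rewrite in_setU1 => /orP[/eqP -> //|/h].
Qed.

Lemma unmatched1 (R : realType) (I : instance R) (M : edge_set I) s :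
  unmatched [set s] M = ~~ matched M s.
Proof.
by rewrite -[[set s]]setU0 unmatchedU1 andb_idr // => _; apply/forall_inP => ?;
  rewrite inE.
Qed.

Lemma sum_available_gt0 (R : realType) (I : instance R) (f : nat -> R)
    (r : request I) (M : edge_set I) :
  (forall n, 0 < f n) -> available M r != set0 ->
  0 < \sum_(s in available M r) f (load r s).
Proof.
move=> f0 /set0Pn[s sA]; rewrite (bigD1 s) //=.
by rewrite ltr_wpDr // sumr_ge0 // => *; apply: ltW.
Qed.

Lemma ocs_prefix_ge0 (R : realType) (I : instance R) (f : nat -> R)
    (p : seq (request I)) M :
  (forall n, 0 < f n) -> 0 <= ocs_prefix f p M.
Proof.
move=> f0; elim/last_ind: p M => [|p r IH] M.
  by rewrite /ocs_prefix /= /dirac ler0n.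
rewrite /ocs_prefix foldl_rcons; apply: sumr_ge0 => M' _.
apply: mulr_ge0; first exact: IH.
rewrite /ocs_step; case: ifP => _; first exact: ler0n.
apply: sumr_ge0 => s _; apply: mulr_ge0; last exact: ler0n.
by apply: divr_ge0; [|apply: sumr_ge0 => ? _]; apply: ltW.
Qed.

Lemma ocs_prefix_total (R : realType) (I : instance R) (f : nat -> R)
    (p : seq (request I)) :
  (forall n, 0 < f n) -> expectation (ocs_prefix f p) (fun=> 1) = 1.
Proof.
move=> f0; elim/last_ind: p => [|p r IH].
  exact: expectation_dirac.
rewrite /ocs_prefix foldl_rcons expectation_bind -[RHS]IH.
apply: eq_bigr => M _; congr (_ * _).
rewrite expectation_step; case: ifPn => // A0.
under eq_bigr do rewrite mulr1.
by rewrite -mulr_suml divff // gt_eqF // sum_available_gt0.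
Qed.

(** * The effect of one arrival on an unmatched set *)

Definition neighbors (R : realType) (I : instance R) (r : request I) :
    {set server I} := [set s | adj s r].

(* The concave map x |-> x / (x + F) lies below its tangent line at c. *)
Lemma tangent_bound (R : realFieldType) (c F x : R) :
  0 <= c -> 0 < F -> 0 <= x ->
  x / (x + F) <= c ^+ 2 / (c + F) ^+ 2 + F / (c + F) ^+ 2 * x.
Proof.
move=> c0 F0 x0.
have cF : 0 < c + F by rewrite ltr_wpDl.
have xF : 0 < x + F by rewrite ltr_wpDl.
rewrite -subr_ge0.
have -> : c ^+ 2 / (c + F) ^+ 2 + F / (c + F) ^+ 2 * x - x / (x + F) =
          F * (c - x) ^+ 2 / ((c + F) ^+ 2 * (x + F)).
  by field; rewrite !gt_eqF.
apply: divr_ge0; first by rewrite mulr_ge0 ?sqr_ge0 // ltW.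
by rewrite mulr_ge0 ?sqr_ge0 // ltW.
Qed.

(** Replacing x / (x + F) by its tangent at [c] makes the bound linear in indicators of unmatched
    sets, so that it can be averaged over [M]. The point [c] is left free here. *)
Lemma expectation_step_unmatched (R : realType) (I : instance R)
    (f : nat -> R) (r : request I) (S : {set server I}) (c : R) (M : edge_set I)
    (F := \sum_(s in neighbors r :&: S) f (load r s)) :
  (forall n, 0 < f n) -> 0 <= c -> neighbors r :&: S != set0 ->
  expectation (ocs_step f r M) (fun M' => (unmatched S M')%:R) <=
  c ^+ 2 / (c + F) ^+ 2 * (unmatched S M)%:R +
  F / (c + F) ^+ 2 * \sum_(s in neighbors r :\: S)
                        f (load r s) * (unmatched (s |: S) M)%:R.
Proof.
move=> f0 c0 /set0Pn[s0 s0NS].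
have F0 : 0 < F.
  by rewrite /F (bigD1 s0) //= ltr_wpDr // sumr_ge0 // => *; apply: ltW.
rewrite expectation_step.
(* Matched servers stay matched, so the left side vanishes when [S] is already hit. *)
have [SM | SM] := boolP (unmatched S M); last first.
  rewrite (_ : (if _ then _ else _) = 0); last first.
    case: ifP => // _; apply: big1 => s _.
    by rewrite unmatched_step (negPf SM) andbF mulr0.
  rewrite mulr0 add0r mulr_ge0 //.
    by rewrite divr_ge0 ?sqr_ge0 // ltW.
  by apply: sumr_ge0 => s _; rewrite mulr_ge0 ?ler0n // ltW.
have AS : available M r :&: S = neighbors r :&: S.
  apply/setP => s; rewrite !inE; case: (boolP (s \in S)) => sS; last first.
    by rewrite !andbF.
  by rewrite (forall_inP SM) // !andbT.
have A0 : available M r != set0.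
  by apply/set0Pn; exists s0; move: s0NS; rewrite -AS inE => /andP[].
rewrite (negPf A0) mulr1.
set x := \sum_(s in neighbors r :\: S) _.
(* As [S] is unmatched, the indicator of [s |: S] only tests whether [s] is free. *)
have xE : x = \sum_(s in available M r :\: S) f (load r s).
  rewrite /x big_mkcond [RHS]big_mkcond; apply: eq_bigr => s _ /=.
  rewrite !inE unmatchedU1 SM andbT; case: (s \in S) => //=.
  by case: (adj s r) => //=; case: (matched M s); rewrite ?mulr1 ?mulr0.
have sumA : \sum_(s in available M r) f (load r s) = x + F.
  by rewrite (big_setID S) /= AS -xE addrC.
rewrite (_ : \sum_(s in available M r) _ = x / (x + F)).
  apply: tangent_bound => //.
  by rewrite xE sumr_ge0 // => *; apply: ltW.
rewrite (big_setID S) /= big1 ?add0r => [|s]; last first.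
  by rewrite inE unmatched_step => /andP[_ ->]; rewrite mulr0.
rewrite xE mulr_suml; apply: eq_bigr => s; rewrite !inE => /andP[sS _].
by rewrite unmatched_step sS SM mulr1 /ocs_prob sumA -xE.
Qed.

(** * The class C_d on finite sets, and loads along a prefix *)

Lemma C_class_gt0 (R : realType) d (f : nat -> R) n : C_class d f -> 0 < f n.
Proof. by case=> fh f0 _; rewrite (lt_le_trans ltr01) // -f0 fh. Qed.

(** Both sides are invariant under reordering, so the defining inequality applies to [A] sorted by
    [l]. *)
Lemma C_class_set (R : realType) (d : nat) (f : nat -> R) (T : finType)
    (A : {set T}) (l : T -> nat) :
  C_class d f -> (#|A| < d)%N ->
  \prod_(s in A) (f (l s).+1 / f (l s))
    <= 1 + (\sum_(s in A) f (l s)) / (d - #|A|)%:R.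
Proof.
case=> _ _ fd Ad.
have [e se pe] : exists2 e, sorted (relpre l leq) e & perm_eq (enum A) e.
  exists (sort (relpre l leq) (enum A)); last by rewrite perm_sym perm_sort.
  by apply: sort_sorted => x y; apply: leq_total.
have sz : size e = #|A| by rewrite -(perm_size pe) cardE.
rewrite -(big_enum _ _ A) -(big_enum +%R _ A) /= !(perm_big _ pe) /= -sz.
rewrite !(big_tnth _ _ e).
apply: fd; rewrite ?sz // => i j ij.
(* Only a default for [nth]; the index [i] shows that [e] is nonempty. *)
have x0 : T := tnth (in_tuple e) i.
rewrite !(tnth_nth x0) /=.
apply: (sorted_leq_nth _ _ x0 se) => //.
- by move=> y x z; apply: leq_trans.
- by move=> x /=.
- by rewrite inE ltn_ord.
- by rewrite inE ltn_ord.
Qed.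

(** Arrivals are distinct, so the requests before [r] are exactly those of [p]. *)
Lemma load_prefix (R : realType) (I : instance R) (p q : seq (request I)) r s :
  arrival I = p ++ r :: q -> load r s = count (adj s) p.
Proof.
move=> arr.
have u : uniq (p ++ r :: q).
  by rewrite -arr (perm_uniq (arrival_perm I)) enum_uniq.
move: (u); rewrite cat_uniq => /and3P[up rp _].
have rNp : r \notin p by apply: contra rp => rp; rewrite /= rp.
have idx r' : arrives_before r' r = (r' \in p).
  rewrite /arrives_before arr !index_cat (negPf rNp) /= eqxx addn0.
  by case: ifP => [|_]; [rewrite index_mem | rewrite ltnNge leq_addr].
rewrite -size_filter /load cardE; apply/perm_size/uniq_perm.
- exact: enum_uniq.
- exact: filter_uniq.
by move=> r'; rewrite mem_enum inE mem_filter idx.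
Qed.

(** * Induction over the arrivals *)

Lemma prob_unmatched_le (R : realType) (I : instance R) (d : nat)
    (f : nat -> R) (p q : seq (request I)) (S : {set server I}) :
  C_class d f -> (forall r : request I, #|neighbors r| <= d)%N ->
  arrival I = p ++ q ->
  expectation (ocs_prefix f p) (fun M => (unmatched S M)%:R)
    <= \prod_(s in S) (f (count (adj s) p))^-1.
Proof.
move=> fC hdeg; have f0 n : 0 < f n by apply: C_class_gt0 fC.
(* [S] must vary, since the step for [S] uses the hypothesis for [s |: S]. *)
elim/last_ind: p q S => [|p r IH] q S arr.
  rewrite /ocs_prefix /= expectation_dirac.
  rewrite big1 => [|s _]; last by case: fC => _ -> _; rewrite invr1.
  by rewrite lern1 leq_b1.
rewrite cat_rcons in arr.
have {}IH := IH _ _ arr.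
have p0 M : 0 <= ocs_prefix f p M by apply: ocs_prefix_ge0.
rewrite [X in expectation X]/ocs_prefix foldl_rcons -/(ocs_prefix f p).
rewrite expectation_bind.
have cntE s : count (adj s) (rcons p r) = (load r s + adj s r)%N.
  by rewrite -cats1 count_cat (load_prefix _ arr) /= addn0.
have Q0 (A : {set server I}) (l : server I -> nat) :
    0 <= \prod_(s in A) (f (l s))^-1.
  by apply: prodr_ge0 => s _; rewrite invr_ge0 ltW.
have [NS0 | NS0] := eqVneq (neighbors r :&: S) set0.
  have adjF s : s \in S -> adj s r = false.
    by move=> sS; move/setP/(_ s): NS0; rewrite !inE sS andbT.
  rewrite (eq_bigr (fun s => (f (count (adj s) p))^-1)); last first.
    by move=> s sS; rewrite cntE adjF // addn0 (load_prefix _ arr).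
  apply: le_trans (IH S); apply: expectation_le => // M.
  rewrite expectation_step; case: ifPn => // A0.
  apply: (@le_trans _ _ (\sum_(s in available M r)
                            ocs_prob f M r s * (unmatched S M)%:R)).
    apply: ler_sum => s _; apply: ler_wpM2l.
      by apply: divr_ge0; [|apply: sumr_ge0 => *]; apply: ltW.
    by rewrite ler_nat unmatched_step; case: (s \notin S).
  by rewrite -mulr_suml -mulr_suml divff ?mul1r // gt_eqF // sum_available_gt0.
set NS := neighbors r :&: S in NS0.
pose F := \sum_(s in NS) f (load r s).
have F0 : 0 < F.
  case/set0Pn: NS0 => s sNS; rewrite /F (bigD1 s) //=.
  by rewrite ltr_wpDr // sumr_ge0 // => *; apply: ltW.
(* The tangent point is the bound on the mean of x relative to [Q]; there the two tangent terms add
   up to c / (c + F). *)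
pose c : R := (d - #|NS|)%:R.
have c0 : 0 <= c by apply: ler0n.
have cF : 0 < c + F by rewrite ltr_wpDl.
pose Q := \prod_(s in S) (f (load r s))^-1.
have {}IH A : expectation (ocs_prefix f p) (fun M => (unmatched A M)%:R)
    <= \prod_(s in A) (f (load r s))^-1.
  by under eq_bigr do rewrite (load_prefix _ arr).
apply: (@le_trans _ _ (c / (c + F) * Q)).
  apply: le_trans (expectation_le p0
    (fun M => expectation_step_unmatched M f0 c0 NS0)) _.
  rewrite expectationD !expectationZ expectation_sum.
  apply: (@le_trans _ _ (c ^+ 2 / (c + F) ^+ 2 * Q +
                         F / (c + F) ^+ 2 * (c * Q))).
    apply: lerD; apply: ler_wpM2l; rewrite ?divr_ge0 ?sqr_ge0 ?(ltW F0) //.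
    (* The weight f(l_s) cancels the extra factor 1 / f(l_s) of the bound for [s |: S], so each of
       the at most d - m neighbors outside [S] contributes at most [Q]. *)
    apply: (@le_trans _ _ (\sum_(s in neighbors r :\: S) Q)).
      apply: ler_sum => s; rewrite inE => /andP[sS _].
      rewrite expectationZ mulrC -ler_pdivlMr // mulrC.
      by apply: le_trans (IH _) _; rewrite big_setU1.
    rewrite sumr_const -[Q *+ _]mulr_natl ler_wpM2r ?Q0 // ler_nat.
    by rewrite cardsD leq_sub2r.
  by rewrite le_eqVlt; apply/orP; left; apply/eqP; field; rewrite gt_eqF.
(* Only the loads of servers in [NS] grow, each by one. *)
have QE : \prod_(s in S) (f (count (adj s) (rcons p r)))^-1 =
          (\prod_(s in NS) (f (load r s).+1 / f (load r s)))^-1 * Q.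
  rewrite /Q (big_setID (neighbors r)) [X in _ = _ * X](big_setID (neighbors r)) /=.
  rewrite mulrA [S :&: _]setIC -/NS -prodfV -big_split /=; congr (_ * _).
    apply: eq_bigr => s; rewrite !inE cntE => /andP[-> _].
    by rewrite addn1 invf_div mulrAC divff ?mul1r // gt_eqF.
  by apply: eq_bigr => s; rewrite !inE cntE => /andP[/negPf -> _]; rewrite addn0.
rewrite QE; apply: ler_wpM2r; first exact: Q0.
have P0 : 0 < \prod_(s in NS) (f (load r s).+1 / f (load r s)).
  by apply: prodr_gt0 => s _; apply: divr_gt0.
(* The class inequality covers only m < d. Otherwise [c] is 0: all neighbors of [r] lie in [S], and
   the left factor vanishes. *)
have [NSd | dNS] := ltnP #|NS| d; last first.
  have -> : c = 0 by apply/eqP; rewrite pnatr_eq0 subn_eq0.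
  by rewrite mul0r invr_ge0 ltW.
have cgt0 : 0 < c by rewrite ltr0n subn_gt0.
rewrite -[c / _]invf_div lef_pV2 ?posrE ?divr_gt0 //.
by rewrite mulrDl divff ?gt_eqF //; apply: C_class_set.
Qed.

(** * From single servers to the competitive ratio *)

Lemma OPT_le_sum_weight (R : realType) (I : instance R) :
  OPT I <= \sum_(s : server I) weight s.
Proof.
apply: bigmax_le => [|M _]; first by apply: sumr_ge0 => s _; apply: weight_ge0.
rewrite /matched_weight big_mkcond; apply: ler_sum => s _.
by case: ifP => // _; apply: weight_ge0.
Qed.

Unset Implicit Arguments.

Theorem theoremE3 (R : realType) (k d : nat) (f : nat -> R)
    (hd : (2 <= d)%N) (hkd : (d <= k)%N) (hf : C_class d f) :
  ((1 - (f k)^-1)%:E <=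
    competitive_ratio (fun I => @ocs_law R I f) (fun I => @kd_bounded R I k d))%E.
Proof.
have f0 n : 0 < f n by apply: C_class_gt0 hf.
have [fh f01 _] := hf.
apply: le_ereal_inf_tmp => _ [I [[degk degd] OPT0 ->]].
rewrite lee_fin ler_pdivlMr //.
have fk0 : 0 <= 1 - (f k)^-1 by rewrite subr_ge0 invf_le1 // -f01 fh.
(* Comparing with the weight of all servers, rather than with an optimal matching, reduces the claim
   to one server at a time. *)
apply: le_trans (ler_wpM2l fk0 (OPT_le_sum_weight I)) _.
have -> : ocs_law f = ocs_prefix f (arrival I) by [].
rewrite mulr_sumr /matched_weight.
under [X in _ <= expectation _ X]boolp.eq_fun do rewrite big_mkcond.
rewrite expectation_sum; apply: ler_sum => s _.
have -> : expectation (ocs_prefix f (arrival I))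
    (fun M => if matched M s then weight s else 0) =
  weight s * (1 - expectation (ocs_prefix f (arrival I))
    (fun M => (unmatched [set s] M)%:R)).
  (* Writing 1 as the total mass lets the identity be checked for each edge set. *)
  rewrite -[X in X - _](@ocs_prefix_total _ _ f (arrival I)) //.
  rewrite -[X in _ - X]mul1r -mulNr -expectationZ -expectationD -expectationZ.
  apply: eq_bigr => M _; rewrite unmatched1.
  by case: (matched M s); rewrite ?mulN1r /= ?subrr ?subr0 ?mulr1 ?mulr0.
rewrite mulrC ler_wpM2l ?weight_ge0 // lerB //.
(* After all arrivals the count is the degree of [s], at least [k], and [f] is monotone. *)
apply: le_trans (prob_unmatched_le (q := [::]) _ hf degd _) _.
  by rewrite cats0.
rewrite big_set1 lef_pV2 ?posrE // fh // (leq_trans (degk s)) //.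
rewrite -size_filter cardE; apply/eq_leq/perm_size/uniq_perm.
- exact: enum_uniq.
- by rewrite filter_uniq // (perm_uniq (arrival_perm I)) enum_uniq.
- move=> r; rewrite mem_enum inE mem_filter (perm_mem (arrival_perm I)).
  by rewrite mem_enum andbT.
Qed.
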